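(* Let $M$ be a smooth manifold, $A\subset TM\setminus\mathbf 0$ a conic open subset, and let $L_1,L_2:A\to\mathbb{R}$ be two pseudo-Finsler metrics on $M$ with the same domain $A$. Then $L_1$ and $L_2$ are anisotropically equivalent if and only if their lightcones coincide, i.e. $\{v\in A:L_1(v)=0\}=\{v\in A:L_2(v)=0\}$. Moreover, in such a case, the factor of anisotropy $\mu=L_2/L_1$ on $A$ (i.e. the smooth function $\mu:A\to\mathbb{R}$ without zeroes such that $L_2=\mu L_1$) can be computed as $$\mu(v)=\frac{g^2_v(v,w)}{g^1_v(v,w)},$$ where $g^1$ and $g^2$ are the fundamental tensors of $L_1$ and $L_2$, respectively, and $w$ is any vector in $T_{\pi(v)}M$ such that $g^1_v(v,w)\neq 0$ (and, thus, $g^2_v(v,w)\neq 0$).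
   Context: $\pi:TM\to M$ is the natural projection, $\mathbf 0$ is the zero section. An open subset $A\subset TM\setminus\mathbf 0$ is conic if $\pi(A)=M$ and $\lambda v\in A$ for all $v\in A$, $\lambda>0$. A smooth function $L:A\to\mathbb{R}$ is a pseudo-Finsler metric if (i) $L(\lambda v)=\lambda^2L(v)$ for all $v\in A$, $\lambda>0$; (ii) for every $v\in A$ the fundamental tensor $g_v(u,w)=\frac12\frac{\partial^2}{\partial t\,\partial s}L(v+tu+sw)|_{t=s=0}$, $u,w\in T_{\pi(v)}M$, is nondegenerate. The lightcone of $L$ is $\{v\in A: L(v)=0\}$. Two pseudo-Finsler metrics $L_1,L_2:A\to\mathbb{R}$ are anisotropically equivalent if there exists a smooth function $\mu:A\to\mathbb{R}$ without zeroes such that $L_2=\mu L_1$.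
   Formalization: The formula for μ(v), with g²_v(v,w)≠0, is proved only for lightlike v with any w such that g¹_v(v,w)≠0, or for any v in A with w a multiple of v; off the lightcone it fails for general w, and there μ(v)=L_2(v)/L_1(v) is stated instead. *)

(* Defs.v *)
From HB Require Import structures.
From mathcomp Require Import all_boot all_order all_algebra.
From mathcomp Require Import all_classical all_reals all_analysis.

Set Implicit Arguments.
Unset Strict Implicit.
Unset Printing Implicit Defensive.

Import Order.TTheory GRing.Theory Num.Theory.
Import numFieldNormedType.Exports.

Local Open Scope classical_set_scope.
Local Open Scope ring_scope.

Definition iter_derive (R : realType) (V W : normedModType R)
    (vs : seq V) (f : V -> W) : V -> W :=
  foldr (fun v g x => 'D_v g x) f vs.

(* C^oo on an open set [D]: all iterated directional derivatives exist and are
   Frechet differentiable (hence continuous) at every point of [D].  Only the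
   values of [f] on the open set [D] matter. *)
Definition smooth_on (R : realType) (V W : normedModType R)
    (D : set V) (f : V -> W) : Prop :=
  forall (vs : seq V) (x : V), D x -> differentiable (iter_derive vs f) x.

(* A chart is a homeomorphism from an open set [cdom] onto an open subset of
   R^n; [cmap] and its inverse [cinv] are total functions, whose values
   outside [cdom] and [cmap @` cdom] are irrelevant. *)
Record chart (R : realType) (n : nat) (M : topologicalType) := Chart {
  cdom : set M ;
  cmap : M -> 'rV[R]_n ;
  cinv : 'rV[R]_n -> M ;
  cdom_open : open cdom ;
  cimg_open : open (cmap @` cdom) ;
  cmapK : forall p, cdom p -> cinv (cmap p) = p ;
  cmap_continuous : forall p, cdom p -> {for p, continuous cmap} ;
  cinv_continuous : forall x, (cmap @` cdom) x -> {for x, continuous cinv} }.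

Record manifold (R : realType) (n : nat) := Manifold {
  mspace :> topologicalType ;
  mspace_hausdorff : hausdorff_space mspace ;
  mspace_second_countable : @second_countable mspace ;
  cindex : Type ;
  mchart : cindex -> chart R n mspace ;
  mchart_cover : forall p : mspace, exists i, cdom (mchart i) p ;
  mchart_smooth : forall i j,
    smooth_on (cmap (mchart i) @` (cdom (mchart i) `&` cdom (mchart j)))
              (cmap (mchart j) \o cinv (mchart i)) }.

Lemma diff_comp_near (R : realType) (U V W : normedModType R)
    (f : U -> V) (g : V -> W) (h : U -> W) (x y : U) :
  differentiable f x -> differentiable g (f x) -> differentiable h x ->
  (\near x, h x = g (f x)) -> 'd h x y = 'd g (f x) ('d f x y).
Proof.
move=> df dg dh hgf.
have /= <- := congr1 (@^~ y) (diff_comp df dg).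
have dgf : differentiable (g \o f) x by exact: differentiable_comp.
by rewrite -(deriveE _ dh) -(deriveE _ dgf); exact: near_eq_derive.
Qed.

Section tangent.
Context (R : realType) (n : nat) (M : manifold R n).
Local Notation V := 'rV[R]_n.
Local Notation I := (cindex M).
Local Notation dom i := (cdom (mchart i)).
Local Notation phi i := (cmap (mchart i)).
Local Notation psi i := (cinv (mchart i)).

Implicit Types (p : M) (i j k : I) (x y : V).

(* A tangent vector at [p] is the family of its components in all the charts
   around [p]: these components are related by the differentials of the
   transition maps.  The components in the other charts are set to 0, so that
   a tangent vector is a single family. *)
Definition tangent_family p : pred (I -> V) := fun c =>
  `[< (forall i, ~ dom i p -> c i = 0) /\
      (forall i j, dom i p -> dom j p ->
         c j = 'd (phi j \o psi i) (phi i p) (c i)) >].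

Lemma tangent_familyP p (c : I -> V) :
  reflect ((forall i, ~ dom i p -> c i = 0) /\
           (forall i j, dom i p -> dom j p ->
              c j = 'd (phi j \o psi i) (phi i p) (c i)))
          (c \in tangent_family p).
Proof. exact: asboolP. Qed.

Record tangent p := Tangent {
  component : I -> V ;
  componentP : component \in tangent_family p }.

HB.instance Definition _ p := [isSub for @component p].
HB.instance Definition _ p := [Choice of tangent p by <:].

Lemma tangent_family_submod_closed p : submod_closed (tangent_family p).
Proof.
split=> [|a /= c d].
  by apply/tangent_familyP; split=> // i j _ _; rewrite linear0.
move=> /tangent_familyP[c0 cc] /tangent_familyP[d0 dc].
apply/tangent_familyP; split.
  move=> i ip; rewrite -[LHS]/(a *: c i + d i) c0// d0//.
  by rewrite scaler0 addr0.
move=> i j ip jp; rewrite -[LHS]/(a *: c j + d j) -[X in _ = _ X]/(a *: c i + d i).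
by rewrite linearP (cc i j)// (dc i j).
Qed.

HB.instance Definition _ p := GRing.isSubmodClosed.Build R (I -> V)
  (tangent_family p) (tangent_family_submod_closed p).
HB.instance Definition _ p := [SubChoice_isSubLmodule of tangent p by <:].

Definition tangent_bundle := {p : M & tangent p}.

Definition tpoint p (u : tangent p) : tangent_bundle := Tagged tangent u.

Definition tproj (v : tangent_bundle) : M := tag v.

Definition tvect (v : tangent_bundle) : tangent (tproj v) := tagged v.

Definition tscale (a : R) (v : tangent_bundle) : tangent_bundle :=
  tpoint (a *: tvect v).

Definition zero_section : set tangent_bundle :=
  [set v | tvect v = 0].

Definition tdom i : set tangent_bundle := tproj @^-1` dom i.

(* The chart [T phi i] of the tangent bundle, with values in R^n x R^n, and its
   inverse. *)
Definition tchart i (v : tangent_bundle) : V * V :=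
  (phi i (tproj v), component (tvect v) i).

Definition push i x y : I -> V := fun j =>
  if `[< (phi i @` dom i) x /\ dom j (psi i x) >]
  then 'd (phi j \o psi i) x y else 0.

Lemma transition_differentiable i j p : dom i p -> dom j p ->
  differentiable (phi j \o psi i) (phi i p).
Proof.
by move=> ip jp; apply: (@mchart_smooth _ _ M i j [::] (phi i p)); exists p.
Qed.

Lemma chart_trans i j k p y : dom i p -> dom j p -> dom k p ->
  'd (phi k \o psi i) (phi i p) y =
  'd (phi k \o psi j) (phi j p) ('d (phi j \o psi i) (phi i p) y).
Proof.
move=> ip jp kp.
have pK : psi i (phi i p) = p by rewrite cmapK.
have dij := transition_differentiable ip jp.
have dik := transition_differentiable ip kp.
have fp : (phi j \o psi i) (phi i p) = phi j p by rewrite /= pK.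
have djk : differentiable (phi k \o psi j) ((phi j \o psi i) (phi i p)).
  by rewrite fp; exact: transition_differentiable.
rewrite -fp; apply: diff_comp_near => //.
have ci : {for phi i p, continuous (psi i)}.
  by apply: cinv_continuous; exists p.
have nj : nbhs (psi i (phi i p)) (dom j).
  by rewrite pK; apply: open_nbhs_nbhs; split => //; exact: cdom_open.
have nij : nbhs (phi i p) (psi i @^-1` dom j) by exact: ci nj.
by apply: filterS nij => x jx /=; rewrite cmapK.
Qed.

Lemma push_tangent i x y : push i x y \in tangent_family (psi i x).
Proof.
apply/tangent_familyP; split=> [j jp|j k jp kp].
  by rewrite /push asboolF// => -[].
rewrite /push; have [ix|nix] := pselect ((phi i @` dom i) x); last first.
  by rewrite !asboolF ?linear0// => -[].
rewrite !asboolT//; case: ix jp kp => p ip <-; rewrite cmapK// => jp kp.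
exact: chart_trans.
Qed.

Definition tchart_inv i (xy : V * V) : tangent_bundle :=
  tpoint (Tangent (push_tangent i xy.1 xy.2)).

Lemma tangent_bundle_eq (v w : tangent_bundle) :
  tproj v = tproj w -> component (tvect v) = component (tvect w) -> v = w.
Proof.
case: v w => [p u] [q w]; rewrite /tproj /tvect /= => pq; subst q => uw.
by congr (existT _ _ _); exact: val_inj.
Qed.

Lemma tchartK i v : tdom i v -> tchart_inv i (tchart i v) = v.
Proof.
move=> iv; apply: tangent_bundle_eq => /=; first by rewrite /tproj /= cmapK.
have /tangent_familyP[v0 vc] := componentP (tvect v).
apply/funext => j; rewrite /push /= cmapK//; case: asboolP => [[_ jv]|njv].
  by rewrite -vc.
by rewrite v0// => jv; apply: njv; split => //; exists (tproj v).
Qed.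

Lemma tchart_invK i (xy : V * V) : (phi i @` dom i) xy.1 ->
  tdom i (tchart_inv i xy) /\ tchart i (tchart_inv i xy) = xy.
Proof.
case: xy => x y /= [p ip <-{x}]; split.
  by rewrite /tdom /tproj /= cmapK.
rewrite /tchart /tproj /tvect /= cmapK//; congr pair.
rewrite /push /= asboolT; last by rewrite cmapK//; split => //; exists p.
have dii : differentiable (phi i \o psi i) (phi i p).
  by exact: transition_differentiable.
rewrite -deriveE// -[RHS](derive_id (phi i p)).
apply: near_eq_derive.
have oi : nbhs (phi i p) (phi i @` dom i).
  by apply: open_nbhs_nbhs; split; [exact: cimg_open|exists p].
by apply: filterS oi => _ [q iq <-] /=; rewrite cmapK.
Qed.

(* The topology and the smooth structure of the tangent bundle are those for
   which the bijections [tchart i] of [tdom i] onto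
   [(phi i @` dom i) `*` setT] are charts. *)
Definition topen (A : set tangent_bundle) : Prop :=
  forall i, open (tchart i @` (A `&` tdom i)).

(* Functions on an open subset [A] of the tangent bundle are represented by
   total functions, whose values outside [A] are irrelevant. *)
Definition tsmooth (A : set tangent_bundle) (f : tangent_bundle -> R) : Prop :=
  forall i, smooth_on (tchart i @` (A `&` tdom i)) (f \o tchart_inv i : _ -> R^o).

Definition conic_open (A : set tangent_bundle) : Prop :=
  [/\ topen A,
      A `<=` ~` zero_section,
      tproj @` A = setT &
      forall (v : tangent_bundle) (a : R), A v -> 0 < a -> A (tscale a v)].

Definition fundamental_tensor (L : tangent_bundle -> R) (v : tangent_bundle)
    (u w : tangent (tproj v)) : R :=
  2^-1 * derive1 (fun t : R =>
    derive1 (fun s : R => L (tpoint (tvect v + t *: u + s *: w)) : R^o) 0 : R^o) 0.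

Definition nondegenerate p (g : tangent p -> tangent p -> R) : Prop :=
  forall u, (forall w, g u w = 0) -> u = 0.

Definition pseudo_Finsler (A : set tangent_bundle) (L : tangent_bundle -> R) :
    Prop :=
  [/\ tsmooth A L,
      forall (v : tangent_bundle) (a : R), A v -> 0 < a ->
        L (tscale a v) = a ^+ 2 * L v &
      forall v, A v -> nondegenerate (@fundamental_tensor L v)].

Definition lightcone (A : set tangent_bundle) (L : tangent_bundle -> R) :
    set tangent_bundle :=
  [set v | A v /\ L v = 0].

Definition anisotropy_factor (A : set tangent_bundle)
    (L1 L2 mu : tangent_bundle -> R) : Prop :=
  [/\ tsmooth A mu,
      forall v, A v -> mu v != 0 &
      forall v, A v -> L2 v = mu v * L1 v].

Definition anisotropically_equivalent (A : set tangent_bundle)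
    (L1 L2 : tangent_bundle -> R) : Prop :=
  exists mu, anisotropy_factor A L1 L2 mu.

End tangent.

Arguments fundamental_tensor {R n M} L v u w.

(* Main.v *)
Require Import Defs.
From HB Require Import structures.
From mathcomp Require Import all_boot all_order all_algebra.
From mathcomp Require Import all_classical all_reals all_analysis.
From mathcomp Require Import ring lra.
Import Order.TTheory GRing.Theory Num.Theory.
Import numFieldNormedType.Exports.
Local Open Scope classical_set_scope.
Local Open Scope ring_scope.

Set Implicit Arguments.
Unset Strict Implicit.
Unset Printing Implicit Defensive.

(** Equivalent metrics clearly have the same lightcone, so the content is the
converse: the quotient L2 / L1, defined off the common lightcone, extends to a
smooth function without zeroes.

By homogeneity, g_v(v, w) is half the derivative of L at v in the vertical
direction w ([fundamental_tensorE]).  Nondegeneracy at the nonzero vector v thus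
says that, in a chart of the tangent bundle, L has a nonzero partial derivative
at each point, and everything reduces to a division lemma in a normed space
([local_quotient]): if F and G are smooth, F vanishes where G does, and
D_w G <> 0 at a zero x of G, then F = m G near x with m smooth.  At a zero of G,
differentiating F = m G gives D_u F = m D_u G for each u ([derive_factor]).
With L1, L2 in place of G, F this is the announced formula on the lightcone; it
also shows that g2_v(v, w) / g1_v(v, w) does not depend on w there, so that the
local factors agree with one explicit global function ([quotient_factor]), and
that this function has no zero, L2 being regular too.  Off the lightcone the
formula is only asked for w = c v, where g_v(v, c v) = c L(v) by Euler's
identity ([fundamental_tensor_radial]).

For the division lemma, follow the lines of direction w down to the zero set:
for y near x there is tau(y) with G(y + tau(y) w) = 0, hence also
F(y + tau(y) w) = 0.  With the difference quotient
T_1 F (y, t) = (F(y + t w) - F(y)) / t, extended by D_w F(y) at t = 0, this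
reads
  F(y) = - tau(y) T_1 F (y, tau(y)),   G(y) = - tau(y) T_1 G (y, tau(y)),
so m(y) = (T_1 F / T_1 G)(y, tau(y)), where T_1 G is close to D_w G(x) <> 0.
The two smoothness questions left are both answered by exhibiting a family of
differentiable functions that is stable under differentiation:
- T_1 F is smooth across t = 0, as a member of the family of Taylor quotients
    T_k F (y, t) = (F(y + t w) - sum_(j < k) t^j / j! D_w^j F(y)) / t^k,
  for which  D_(v, r) T_k F = T_k (D_v F) + r (T_k (D_w F) - k T_(k+1) F)
  ([is_diff_taylor_quot], [taylor_quot_smooth]);
- d tau = - dG / D_w G at y + tau(y) w ([is_diff_implicit]), so that the
  derivatives of y |-> f(y, tau(y)), f smooth, are again of this form
  ([Ck_implicit_comp]). *)

(** * Differentials of real-valued functions *)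

Section diff_basics.
Context {R : realType} {V : normedModType R}.
Implicit Types (f g : V -> R) (x v : V) (D : set V).

(** The first-order estimate, stated with an explicit epsilon, that the other
    differentials are computed from. *)
Lemma is_diff_approx f x (df : {linear V -> R}) : continuous df ->
  (forall e, 0 < e -> \forall h \near (0 : V),
    `|f (h + x) - f x - df h| <= e * `|h|) ->
  is_diff x f df.
Proof.
move=> dfc fe.
have H : f \o shift x = cst (f x) + df +o_ (0 : V) id.
  apply/eqaddoP => e e0; have := fe e e0.
  by apply: filterS => h /=; rewrite opprD addrA.
have E : 'd f x = df :> (V -> R) by exact: diff_unique.
by apply: DiffDef => //; apply/diff_locallyP; rewrite E.
Qed.

Lemma is_diff_near f g x (df : V -> R) :
  (\near x, f x = g x) -> is_diff x f df -> is_diff x g df.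
Proof.
move=> fg [dfx <-]; apply: is_diff_approx; first exact: diff_continuous.
move=> e e0.
have /diff_locally/eqaddoP/(_ e e0) := dfx.
have : \forall h \near (0 : V), f (h + x) = g (h + x).
  move: fg; rewrite (near_shift 0 x) /=.
  by apply: filterS => h /=; rewrite subr0.
apply: filterS2 => h fgh; rewrite -fgh -(nbhs_singleton fg) /=.
by rewrite !fctE opprD addrA.
Qed.

Lemma is_diff_derive f x (df : V -> R) v : is_diff x f df -> 'D_v f x = df v.
Proof. by case=> dfx <-; rewrite deriveE. Qed.

Lemma is_diff_add f g (df dg : V -> R) x : is_diff x f df -> is_diff x g dg ->
  is_diff x (fun y => f y + g y) (fun v => df v + dg v).
Proof. exact: is_diffD. Qed.

Lemma is_diff_mul f g (df dg : V -> R) x : is_diff x f df -> is_diff x g dg ->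
  is_diff x (fun y => f y * g y) (fun v => f x * dg v + g x * df v).
Proof. exact: is_diffM. Qed.

Lemma is_diff_mulc f (df : V -> R) c x : is_diff x f df ->
  is_diff x (fun y => f y * c) (fun v => df v * c).
Proof.
move=> dfx; have H := is_diff_mul dfx (is_diff_cst c x).
apply: is_diff_eq H _; apply/funext => v.
by rewrite [X in f x * X]/(0 : R) mulr0 add0r mulrC.
Qed.

Lemma is_diff_inv f (df : V -> R) x : f x != 0 -> is_diff x f df ->
  is_diff x (fun y => (f y)^-1) (fun v => - (f x) ^- 2 * df v).
Proof.
move=> fx0 [dfx <-]; apply: DiffDef; first exact: differentiableV.
by rewrite diffV.
Qed.

(** A factor that is merely continuous does no harm where the other factor
    vanishes: in g(x + h) (f(x + h) - f(x)) the increment of g is multiplied by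
    a quantity of order h.  This is what differentiates both Taylor quotients at
    t = 0 and the implicit function. *)
Lemma is_diff_mul_eq0 f g x : differentiable f x -> f x = 0 ->
  {for x, continuous g} ->
  is_diff x (fun y => f y * g y) (fun v => g x * 'd f x v).
Proof.
move=> dfx fx0 gc.
apply: (@is_diff_approx _ _ (g x \*: 'd f x)).
  move=> y; apply: continuousZl_tmp; exact: diff_continuous.
move=> e e0; rewrite fx0 mul0r.
have [C C0 dC] : exists2 C, 0 < C & forall h, `|'d f x h| <= C * `|h|.
  have := @linear_lipschitz _ _ _ ('d f x) (diff_continuous dfx).
  by move=> [C C0 dC]; exists C.
pose G := `|g x| + 1.
have G0 : 0 < G by rewrite ltr_wpDl.
have eG : 0 < e / 2 / G by rewrite !divr_gt0.
have eC : 0 < Num.min (e / 2 / C) 1 by rewrite lt_min !divr_gt0/=.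
have /diff_locally/eqaddoP/(_ _ eG) := dfx.
have : \forall h \near (0 : V), `|g (h + x) - g x| < Num.min (e / 2 / C) 1.
  have : \forall y \near x, `|g x - g y| < Num.min (e / 2 / C) 1.
    by have /cvgrPdist_lt/(_ _ eC) := gc.
  rewrite (near_shift 0 x)/=; apply: filterS => h /=.
  by rewrite subr0 distrC.
apply: filterS2 => h gh fh.
have {}fh : `|f (h + x) - 'd f x h| <= e / 2 / G * `|h|.
  by move: fh; rewrite !fctE /= fx0 add0r.
have -> : f (h + x) * g (h + x) - 0 - g x * 'd f x h =
  (f (h + x) - 'd f x h) * g (h + x) + 'd f x h * (g (h + x) - g x) by ring.
move: gh; rewrite lt_min => /andP[gh1 gh2].
have gh3 : `|g (h + x)| <= G.
  rewrite -[g (h + x)](subrK (g x)) addrC (le_trans (ler_normD _ _))//.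
  by rewrite lerD2l ltW.
rewrite (le_trans (ler_normD _ _))// !normrM [e in leRHS]splitr mulrDl lerD//.
  rewrite (le_trans (ler_pM _ _ fh gh3))//.
  suff -> : e / 2 / G * `|h| * G = e / 2 * `|h| by [].
  by field; rewrite gt_eqF.
rewrite (le_trans (ler_pM _ _ (dC h) (ltW gh1)))//.
suff -> : C * `|h| * (e / 2 / C) = e / 2 * `|h| by [].
by field; rewrite gt_eqF.
Qed.

End diff_basics.

(** * Smoothness by orders of differentiability *)

Section smoothness.
Context {R : realType} {V : normedModType R}.
Implicit Types (f g : V -> R) (D : set V).

(** Finite orders of differentiability, by recursion on the first
    derivatives: closure properties of smooth functions become inductions on
    [k], which [smooth_on], a statement on iterated derivatives, does not
    offer directly. *)
Fixpoint Ck (k : nat) (D : set V) (f : V -> R) : Prop :=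
  (forall x, D x -> differentiable f x) /\
  (if k is j.+1 then forall v, Ck j D (fun x => 'D_v f x) else True).

Lemma smooth_on_derive D f v :
  smooth_on D f -> smooth_on D (fun x => 'D_v f x).
Proof.
move=> fs vs x Dx; have := fs (rcons vs v) x Dx.
by rewrite /iter_derive foldr_rcons.
Qed.

Lemma smooth_on_diff D f x : smooth_on D f -> D x -> differentiable f x.
Proof. by move=> fs Dx; apply: (fs [::]). Qed.

Lemma smooth_onP D f : smooth_on D f <-> forall k, Ck k D f.
Proof.
split=> [fs k|fC vs].
  elim: k f fs => [|k IH] f fs; split=> //; try exact: (fs [::]).
  by move=> v; apply/IH/smooth_on_derive.
move: {fC}(fC (size vs)); elim/last_ind: vs f => [|vs v IH] f; first by case.
rewrite size_rcons => -[_ fC] x Dx.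
by have := IH _ (fC v) x Dx; rewrite /iter_derive foldr_rcons.
Qed.

Lemma Ck_diff k D f x : Ck k D f -> D x -> differentiable f x.
Proof. by case: k => [|k] [+ _]; apply. Qed.

Lemma CkW k D f : Ck k.+1 D f -> Ck k D f.
Proof.
elim: k f => [|k IH] f [df fC]; split=> //.
by move=> v; apply: IH.
Qed.

Lemma smooth_on_sub D E f : E `<=` D -> smooth_on D f -> smooth_on E f.
Proof. by move=> ED fs vs x /ED; exact: fs. Qed.

Lemma iter_derive_eq_on D f g vs : open D -> (forall x, D x -> f x = g x) ->
  forall x, D x -> iter_derive vs f x = iter_derive vs g x.
Proof.
move=> Do fg; elim: vs => //= v vs IH x Dx.
apply: near_eq_derive; apply: filterS (open_nbhs_nbhs (conj Do Dx)).
exact: IH.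
Qed.

Lemma smooth_on_local D f :
  (forall x, D x -> exists2 U, open_nbhs x U &
     exists2 g, smooth_on U g & forall y, U y -> f y = g y) ->
  smooth_on D f.
Proof.
move=> H vs x /H[U [Uo Ux] [g gs fg]].
have /= dg := gs vs x Ux.
suff: is_diff x (iter_derive vs f) ('d (iter_derive vs g) x) by case.
apply: is_diff_near (differentiableP dg).
apply: filterS (open_nbhs_nbhs (conj Uo Ux)) => y Uy.
by apply/esym/(iter_derive_eq_on vs Uo fg).
Qed.

Lemma Ck_eq k D f g : open D -> (forall x, D x -> f x = g x) ->
  Ck k D g -> Ck k D f.
Proof.
move=> Do.
have near_eq (h1 h2 : V -> R) x : (forall x, D x -> h1 x = h2 x) -> D x ->
    \near x, h2 x = h1 x.
  move=> h12 Dx; apply: filterS (open_nbhs_nbhs (conj Do Dx)) => y Dy.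
  by rewrite h12.
have diff_eq (h1 h2 : V -> R) : (forall x, D x -> h1 x = h2 x) ->
    forall x, D x -> differentiable h2 x -> differentiable h1 x.
  move=> h12 x Dx dh; suff: is_diff x h1 ('d h2 x) by case.
  exact: is_diff_near (near_eq _ _ _ h12 Dx) (differentiableP dh).
elim: k f g => [|k IH] f g fg [dg gC]; split=> //.
- by move=> x Dx; exact: diff_eq fg _ Dx (dg x Dx).
- by move=> x Dx; exact: diff_eq fg _ Dx (dg x Dx).
- by move=> v; apply: IH (gC v) => x Dx; exact/esym/near_eq_derive/near_eq.
Qed.

(** The step of the inductions on the order: it is enough to know a formula
    for the differential, and that this formula is one order less regular. *)
Lemma Ck_intro k D f (df : V -> V -> R) : open D ->
  (forall x, D x -> is_diff x f (df x)) ->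
  (forall v, Ck k D (fun x => df x v)) -> Ck k.+1 D f.
Proof.
move=> Do dfE dfC; split=> [x /dfE[]//|v].
by apply: Ck_eq (dfC v) => // x /dfE; apply: is_diff_derive.
Qed.

Lemma Ck0_intro D f (df : V -> V -> R) :
  (forall x, D x -> is_diff x f (df x)) -> Ck 0 D f.
Proof. by move=> dfE; split=> // x /dfE[]. Qed.

Lemma Ck_cst k D c : Ck k D (fun=> c).
Proof.
elim: k c => [|k IH] c; split=> // v.
have -> : (fun x : V => 'D_v (fun=> c) x) = fun=> 0.
  by apply/funext => x; exact: derive_cst.
exact: IH.
Qed.

Lemma CkD k D f g : open D -> Ck k D f -> Ck k D g ->
  Ck k D (fun x => f x + g x).
Proof.
move=> Do; elim: k f g => [|k IH] f g fC gC;
have H x (Dx : D x) := is_diff_add (differentiableP (Ck_diff fC Dx))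
                                   (differentiableP (Ck_diff gC Dx)).
  exact: Ck0_intro H.
apply: (Ck_intro Do H) => v.
apply: Ck_eq Do _ (IH _ _ (fC.2 v) (gC.2 v)) => x Dx.
by rewrite !deriveE//; apply: Ck_diff Dx; eassumption.
Qed.

Lemma CkM k D f g : open D -> Ck k D f -> Ck k D g ->
  Ck k D (fun x => f x * g x).
Proof.
move=> Do; elim: k f g => [|k IH] f g fC gC;
have H x (Dx : D x) := is_diff_mul (differentiableP (Ck_diff fC Dx))
                                   (differentiableP (Ck_diff gC Dx)).
  exact: Ck0_intro H.
apply: (Ck_intro Do H) => v.
have dC := CkD Do (IH _ _ (CkW fC) (gC.2 v)) (IH _ _ (CkW gC) (fC.2 v)).
apply: Ck_eq Do _ dC => x Dx.
by rewrite !deriveE//; apply: Ck_diff Dx; eassumption.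
Qed.

Lemma CkV k D f : open D -> (forall x, D x -> f x != 0) -> Ck k D f ->
  Ck k D (fun x => (f x)^-1).
Proof.
move=> Do f0; elim: k => [|k IH] fC;
have H x (Dx : D x) := is_diff_inv (f0 x Dx) (differentiableP (Ck_diff fC Dx)).
  exact: Ck0_intro H.
apply: (Ck_intro Do H) => v.
have fVC := IH (CkW fC).
have dC := CkM Do (Ck_cst _ _ (-1)) (CkM Do (CkM Do fVC fVC) (fC.2 v)).
apply: Ck_eq Do _ dC => x Dx.
rewrite deriveE; first by rewrite mulN1r -invfM -expr2 mulNr.
exact: Ck_diff fC Dx.
Qed.

End smoothness.

(** * Mean values and symmetry of second derivatives *)

Section mean_value.
Context {R : realType} {V : normedModType R}.
Implicit Types (F : V -> R) (x v w : V) (D : set V).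

Lemma mvt_line F x w :
  (forall s : R, 0 <= s <= 1 -> differentiable F (x + s *: w)) ->
  exists2 s : R, 0 <= s <= 1 & F (x + w) - F x = 'D_w F (x + s *: w).
Proof.
move=> dF; pose f (s : R) := F (x + s *: w).
have df (s : R) : 0 <= s <= 1 -> is_derive s 1 f ('D_w F (x + s *: w)).
  move=> /dF dFs.
  have dl : is_diff s (fun s : R => x + s *: w) (fun r => r *: w).
    have H := is_diffD (is_diff_cst x s) (is_diff_scalel s w).
    by apply: is_diff_eq H _; apply/funext => r /=; rewrite fctE add0r.
  have H := is_diff_comp dl (differentiableP dFs).
  have ds : differentiable f s by case: H.
  apply: DeriveDef; first exact: diff_derivable.
  by rewrite (is_diff_derive _ H) /= scale1r deriveE.
have [||s sI] := @MVT_segment R f (fun s => 'D_w F (x + s *: w)) 0 1 ler01.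
- by move=> s; rewrite in_itv/= => /andP[s0 s1]; apply: df; rewrite !ltW.
- apply: derivable_within_continuous => s sI.
  have sI' : 0 <= s <= 1 by move: sI; rewrite in_itv.
  by case: (df s sI').
- rewrite /f scale1r scale0r addr0 subr0 mulr1 => H.
  by exists s => //; move: sI; rewrite in_itv.
Qed.

Lemma mvt_ray F x w (t : R) :
  (forall s : R, 0 <= s <= 1 -> differentiable F (x + (s * t) *: w)) ->
  exists2 s : R, 0 <= s <= 1 &
    F (x + t *: w) - F x = t * 'D_w F (x + (s * t) *: w).
Proof.
move=> dF; have [|s sI E] := @mvt_line F x (t *: w).
  by move=> s sI; rewrite scalerA; exact: dF.
exists s => //; rewrite E scalerA; have dFs := dF s sI.
by rewrite !deriveE // linearZ.
Qed.

(** The mean value theorem in direction [v], applied to y |-> F(y + d w) - F(y),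
    then in direction [w], applied to D_v F. *)
Lemma second_difference D F x v w (d : R) : 0 <= d -> smooth_on D F ->
  (forall a b : R, 0 <= a <= d -> 0 <= b <= d -> D (x + a *: v + b *: w)) ->
  exists a, exists2 b, (0 <= a <= d) && (0 <= b <= d) &
    F (x + d *: v + d *: w) - F (x + d *: v) - (F (x + d *: w) - F x) =
    d * (d * 'D_w (fun y => 'D_v F y) (x + a *: v + b *: w)).
Proof.
move=> d0 Fs Dx.
have sd (s : R) : 0 <= s <= 1 -> 0 <= s * d <= d.
  by move=> /andP[s0 s1]; rewrite mulr_ge0//= ler_piMl.
have dF y := smooth_on_diff Fs (x := y).
pose g y := F (y + d *: w) - F y.
have dg (s : R) : 0 <= s <= 1 -> is_diff (x + (s * d) *: v) g
    (fun u => 'd F (x + (s * d) *: v + d *: w) u - 'd F (x + (s * d) *: v) u).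
  move=> /sd sI.
  have D1 : differentiable F (x + (s * d) *: v + d *: w).
    by apply/dF/Dx => //; rewrite d0 lexx.
  have D2 : differentiable F (x + (s * d) *: v).
    by rewrite -[_ + _]addr0 -(scale0r w); apply/dF/Dx => //; rewrite lexx.
  have D3 : is_diff (x + (s * d) *: v) (fun y => y + d *: w) id.
    have H := is_diffD (is_diff_id (x + (s * d) *: v)) (is_diff_cst (d *: w) _).
    by apply: is_diff_eq H _; apply/funext => r /=; rewrite fctE addr0.
  have := is_diffB (is_diff_comp D3 (differentiableP D1)) (differentiableP D2).
  exact.
have [|s sI gE] := @mvt_ray g x v d; first by move=> s /dg[].
have sdI := sd s sI.
have [|r rI E] := @mvt_ray (fun y => 'D_v F y) (x + (s * d) *: v) w d.
  move=> r /sd rI; apply: smooth_on_diff (smooth_on_derive v Fs) _.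
  exact: Dx.
exists (s * d), (r * d); first by rewrite sdI sd.
rewrite -E -[LHS]/(g (x + d *: v) - g x) gE; congr (_ * _).
rewrite (is_diff_derive v (dg s sI)) !deriveE//.
  by rewrite -[_ + _]addr0 -(scale0r w); apply/dF/Dx => //; rewrite lexx.
by apply/dF/Dx => //; rewrite d0 lexx.
Qed.

Lemma open_box D x v w : open D -> D x -> exists2 d : R, 0 < d &
  forall a b : R, `|a| <= d -> `|b| <= d -> D (x + a *: v + b *: w).
Proof.
move=> Do Dx; have /nbhs_ballP[r /= r0 rD] := open_nbhs_nbhs (conj Do Dx).
have N0 : 0 < `|v| + `|w| + 1 by rewrite ltr_wpDl// addr_ge0.
exists (r / (`|v| + `|w| + 1)); first by rewrite divr_gt0.
move=> a b ad bd; apply: rD; rewrite -ball_normE /=.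
rewrite -addrA opprD addrA subrr sub0r normrN.
rewrite (le_lt_trans (ler_normD _ _))// !normrZ.
rewrite (@le_lt_trans _ _ (r / (`|v| + `|w| + 1) * (`|v| + `|w|)))//.
  by rewrite mulrDr lerD// ler_wpM2r.
rewrite mulrAC ltr_pdivrMr// ltr_pM2l//; lra.
Qed.

Lemma eq_at_of_near_values (f g : V -> R) x :
  {for x, continuous f} -> {for x, continuous g} ->
  (forall U, open_nbhs x U -> exists p q, [/\ U p, U q & f p = g q]) ->
  f x = g x.
Proof.
move=> cf cg fg; apply/eqP; rewrite -subr_eq0 -normr_le0.
apply/ler_addgt0Pl => e e0; rewrite addr0.
have e2 : 0 < e / 2 by rewrite divr_gt0.
have : nbhs x ([set y | `|f x - f y| < e / 2] `&`
               [set y | `|g x - g y| < e / 2]).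
  by apply: filterI; [move/cvgrPdist_lt : cf|move/cvgrPdist_lt : cg]; apply.
rewrite nbhsE => -[U Ux UP].
have [p [q [/UP[/= hf _] /UP[_ /= hg] E]]] := fg U Ux.
rewrite ltW// [e]splitr -(subrK (g q) (f x)) -addrA.
by rewrite (le_lt_trans (ler_normD _ _))// ltrD// -?E// distrC E.
Qed.

(** Schwarz: the second difference of [F] over a small parallelogram is
    symmetric in [v] and [w], and it is a value of either mixed derivative. *)
Lemma derive_comm D F x v w : open D -> smooth_on D F -> D x ->
  'D_v (fun y => 'D_w F y) x = 'D_w (fun y => 'D_v F y) x.
Proof.
move=> Do Fs Dx.
apply: (@eq_at_of_near_values (fun y => 'D_v (fun y => 'D_w F y) y)
                              (fun y => 'D_w (fun y => 'D_v F y) y)).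
- apply: differentiable_continuous.
  exact: smooth_on_diff (smooth_on_derive _ (smooth_on_derive _ Fs)) Dx.
- apply: differentiable_continuous.
  exact: smooth_on_diff (smooth_on_derive _ (smooth_on_derive _ Fs)) Dx.
move=> U [Uo Ux].
have [d d0 dUD] := open_box v w (openI Do Uo) (conj Dx Ux).
have dn (a : R) : 0 <= a <= d -> `|a| <= d.
  by move=> /andP[a0 ad]; rewrite ger0_norm.
have dD (a b : R) : 0 <= a <= d -> 0 <= b <= d -> D (x + a *: v + b *: w).
  by move=> /dn ad /dn bd; case: (dUD a b ad bd).
have dU (a b : R) : 0 <= a <= d -> 0 <= b <= d -> U (x + a *: v + b *: w).
  by move=> /dn ad /dn bd; case: (dUD a b ad bd).
have [a [b /andP[aI bI] E1]] := second_difference (ltW d0) Fs dD.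
have [|b' [a' /andP[bI' aI'] E2]] := @second_difference D F x w v d (ltW d0) Fs.
  by move=> a' b' aI' bI'; rewrite addrAC; exact: dD.
exists (x + a' *: v + b' *: w), (x + a *: v + b *: w).
split; [exact: dU|exact: dU|].
have dn0 := lt0r_neq0 d0.
apply: (mulfI dn0 (mulfI dn0 _)); apply: etrans E1.
rewrite (addrAC x (a' *: v)); apply: etrans (esym E2) _.
rewrite (addrAC x (d *: w)).
by move: (F _) (F _) (F _) (F _) => ? ? ? ?; ring.
Qed.

End mean_value.

(** * Smoothness of Taylor quotients *)

Section taylor_quotient.
Context {R : realType} {V : normedModType R}.
Context (D : set V) (w : V) (Do : open D).
Implicit Types (F : V -> R) (x : V) (p : V * R).

Lemma is_diff_fst p : is_diff p (fst : V * R -> V) fst.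
Proof.
apply: DiffDef; first by apply: linear_differentiable => q; exact: cvg_fst.
by rewrite diff_lin// => q; exact: cvg_fst.
Qed.

Lemma is_diff_snd p : is_diff p (snd : V * R -> R) snd.
Proof.
apply: DiffDef; first by apply: linear_differentiable => q; exact: cvg_snd.
by rewrite diff_lin// => q; exact: cvg_snd.
Qed.

Definition slide p : V := p.1 + p.2 *: w.

Lemma is_diff_slide p : is_diff p slide slide.
Proof.
apply: is_diffD; first exact: is_diff_fst.
have H := is_diff_comp (is_diff_snd p) (is_diff_scalel p.2 w).
exact: H.
Qed.

Definition slide_dom : set (V * R) := [set p | D p.1 /\ D (slide p)].

Lemma slide_dom_open : open slide_dom.
Proof.
apply: openI.
  by apply: open_comp => // p _; exact: cvg_fst.
apply: open_comp => // p _.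
by have [d _] := is_diff_slide p; exact: differentiable_continuous.
Qed.

Definition iter_D k F : V -> R := iter k (fun f x => 'D_w f x) F.

Lemma iter_D_smooth k F : smooth_on D F -> smooth_on D (iter_D k F).
Proof. by move=> Fs; elim: k => //= k IH; exact: smooth_on_derive. Qed.

Lemma iter_DS k F x : iter_D k.+1 F x = iter_D k (fun y => 'D_w F y) x.
Proof. by rewrite /iter_D iterSr. Qed.

Lemma derive_iter_D k F x v : smooth_on D F -> D x ->
  'D_v (iter_D k F) x = iter_D k (fun y => 'D_v F y) x.
Proof.
move=> Fs; elim: k x => //= k IH x Dx.
rewrite (derive_comm _ _ Do (iter_D_smooth k Fs) Dx).
apply: near_eq_derive; apply: filterS (open_nbhs_nbhs (conj Do Dx)).
exact: IH.
Qed.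

Fixpoint taylor_rem k F p : R :=
  if k is j.+1 then taylor_rem j F p - p.2 ^+ j / j`!%:R * iter_D j F p.1
  else F (slide p).

Lemma is_diff_taylor_rem0 F p : smooth_on D F -> slide_dom p ->
  is_diff p (taylor_rem 0 F) (fun q =>
    taylor_rem 0 (fun y => 'D_(q.1) F y) p +
    q.2 * taylor_rem 0 (fun y => 'D_w F y) p).
Proof.
move=> Fs [_ Dp]; have dF := smooth_on_diff Fs Dp.
apply: is_diff_eq (is_diff_comp (is_diff_slide p) (differentiableP dF)) _.
by apply/funext => q /=; rewrite linearD linearZ !deriveE.
Qed.

Lemma is_diff_snd_exp (n : nat) p :
  is_diff p (fun p => p.2 ^+ n) (fun q => n%:R * p.2 ^+ n.-1 * q.2).
Proof.
case: n => [|n].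
  have -> : (fun p : V * R => p.2 ^+ 0) = cst 1 by [].
  by apply: is_diff_eq; apply/funext => q; rewrite !mul0r.
have -> : (fun p : V * R => p.2 ^+ n.+1) = snd ^+ n.+1 by rewrite exprfctE.
exact: is_diff_eq (is_diffX n (is_diff_snd p)) _.
Qed.

Lemma is_diff_taylor_term j F p : smooth_on D F -> D p.1 ->
  is_diff p (fun p => p.2 ^+ j / j`!%:R * iter_D j F p.1) (fun q =>
    p.2 ^+ j / j`!%:R * iter_D j (fun y => 'D_(q.1) F y) p.1 +
    q.2 * (j%:R * p.2 ^+ j.-1 / j`!%:R * iter_D j F p.1)).
Proof.
move=> Fs Dp.
have dF := smooth_on_diff (iter_D_smooth j Fs) Dp.
have H1 := is_diff_comp (is_diff_fst p) (differentiableP dF).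
have H2 := is_diff_mulc j`!%:R^-1 (is_diff_snd_exp j p).
apply: is_diff_eq (is_diff_mul H2 H1) _; apply/funext => q /=.
rewrite -derive_iter_D// deriveE// /=; ring.
Qed.

(** Differentiating t^j / j! lowers j by one, and D_w^j F is D_w^(j - 1) of
    D_w F: in direction t, the terms of the remainder shift by one place. *)
Lemma is_diff_taylor_rem k F p : smooth_on D F -> slide_dom p ->
  is_diff p (taylor_rem k.+1 F) (fun q =>
    taylor_rem k.+1 (fun y => 'D_(q.1) F y) p +
    q.2 * taylor_rem k (fun y => 'D_w F y) p).
Proof.
move=> Fs Op; elim: k => [|k IH].
  have H := is_diffB (is_diff_taylor_rem0 Fs Op)
                     (is_diff_taylor_term 0 Fs Op.1).
  by apply: is_diff_eq H _; apply/funext => q; rewrite !fctE /=; ring.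
have H := is_diffB IH (is_diff_taylor_term k.+1 Fs Op.1).
apply: is_diff_eq H _; apply/funext => q; rewrite !fctE /= -iter_DS /=.
have k0 : (k`!%:R : R) != 0 by rewrite pnatr_eq0 -lt0n fact_gt0.
rewrite factS natrM; field.
by rewrite k0 nat1r pnatr_eq0.
Qed.

Lemma iter_D_cst0 k x : iter_D k (fun=> 0) x = 0.
Proof.
elim: k x => //= k IH x; rewrite -[RHS](derive_cst (0 : R) x w).
by apply: near_eq_derive; apply: nearW => y; exact: IH.
Qed.

Lemma taylor_rem_cst0 k p : taylor_rem k (fun=> 0) p = 0.
Proof. by elim: k => //= k ->; rewrite iter_D_cst0 mulr0 subrr. Qed.

Lemma taylor_rem_at0 k F x : taylor_rem k.+1 F (x, 0) = 0.
Proof.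
elim: k => [|k IH] /=.
  by rewrite /slide /= scale0r addr0 expr0 divr1 mul1r subrr.
by move: IH => /= ->; rewrite exprS !mul0r subrr.
Qed.

(** By induction on [k]: subtracting c t^k from the remainder, with
    c = D_w^k F(x) / k!, gives a function that vanishes at t = 0 and whose
    derivative in t is the same expression for D_w F and k - 1; the mean value
    theorem gains the factor t.  The base point of the remainder moves with
    [p], while c is taken at the fixed point [x]. *)
Lemma taylor_rem_approx k F x : smooth_on D F -> D x -> forall e, 0 < e ->
  \forall p \near (x, 0 : R),
    `|taylor_rem k F p - iter_D k F x / k`!%:R * p.2 ^+ k| <= e * `|p.2| ^+ k.
Proof.
move=> Fs Dx; elim: k F Fs => [|k IH] F Fs e e0.
  have sx : slide (x, 0) = x by rewrite /slide/= scale0r addr0.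
  have cF : {for (x, 0 : R), continuous (F \o slide)}.
    apply: continuous_comp.
      by apply: differentiable_continuous; case: (is_diff_slide (x, 0)).
    by rewrite sx; apply/differentiable_continuous/(smooth_on_diff Fs Dx).
  move/cvgrPdist_lt : cF => /(_ e e0); apply: filterS => p /= /ltW.
  by rewrite sx expr0 !mulr1 divr1 distrC.
have Fs' := smooth_on_derive w Fs.
have : nbhs (x, 0 : R) (slide_dom `&`
   [set p | `|taylor_rem k (fun y => 'D_w F y) p -
      iter_D k (fun y => 'D_w F y) x / k`!%:R * p.2 ^+ k| <= e * `|p.2| ^+ k]).
  apply: filterI; last exact: IH.
  apply: open_nbhs_nbhs; split; first exact: slide_dom_open.
  by split=> //; rewrite /slide/= scale0r addr0.
move=> /nbhs_ballP[d /= d0 dP]; apply/nbhs_ballP; exists d => //= -[y t] yt.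
have yst s : 0 <= s <= 1 -> ball (x, 0 : R) d (y, s * t).
  case: yt => /= yx t0 /andP[s0 s1]; split=> //=.
  move: t0; rewrite -!ball_normE /= !sub0r !normrN normrM ger0_norm//.
  by apply: le_lt_trans; rewrite ler_piMl.
pose a := iter_D k.+1 F x / k.+1`!%:R.
have dG p : slide_dom p ->
    is_diff p (fun p => taylor_rem k.+1 F p - a * p.2 ^+ k.+1) (fun q =>
      taylor_rem k.+1 (fun y => 'D_(q.1) F y) p +
      q.2 * taylor_rem k (fun y => 'D_w F y) p -
      a * (k.+1%:R * p.2 ^+ k * q.2)).
  move=> Op; have := is_diffB (is_diff_taylor_rem k Fs Op)
    (is_diffZ a (is_diff_snd_exp k.+1 p)).
  exact.
have ysE s : (y, 0 : R) + s *: (0, t) = (y, s * t).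
  rewrite -[LHS]/(y + s *: (0 : V), 0 + s * t).
  by rewrite scaler0 addr0 add0r.
(* The mean value theorem on the segment from (y, 0) to (y, t). *)
have [|s sI] := @mvt_line _ _
    (fun p => taylor_rem k.+1 F p - a * p.2 ^+ k.+1) (y, 0) (0, t).
  by move=> s /yst/dP[Op _]; rewrite ysE; case: (dG _ Op).
have [Op hs] := dP _ (yst s sI).
have -> : (y, 0 : R) + (0, t) = (y, t).
  rewrite -[LHS]/(y + 0, 0 + t).
  by rewrite addr0 add0r.
rewrite ysE (is_diff_derive (0, t) (dG _ Op)).
have -> : (fun y => 'D_(0, t).1 F y) = fun=> 0.
  by apply/funext => z; rewrite /= derive0.
rewrite taylor_rem_cst0 taylor_rem_at0 [(y, 0).2]/= expr0n mulr0 !subr0 => ->.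
rewrite add0r /=.
have k0 : (k`!%:R : R) != 0 by rewrite pnatr_eq0 -lt0n fact_gt0.
have -> : a = iter_D k (fun y => 'D_w F y) x / (k.+1%:R * k`!%:R).
  by rewrite /a iter_DS factS natrM.
have -> : t * taylor_rem k (fun y => 'D_w F y) (y, s * t) -
   iter_D k (fun y => 'D_w F y) x / (k.+1%:R * k`!%:R) *
     (k.+1%:R * (s * t) ^+ k * t) =
  t * (taylor_rem k (fun y => 'D_w F y) (y, s * t) -
    iter_D k (fun y => 'D_w F y) x / k`!%:R * (s * t) ^+ k).
  by field; rewrite k0 nat1r pnatr_eq0.
rewrite normrM exprS mulrCA ler_wpM2l//; apply: le_trans hs _.
rewrite ler_wpM2l ?(ltW e0)// lerXn2r ?nnegrE//= normrM.
by case/andP: sI => s0 s1; rewrite ger0_norm// ler_piMl.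
Qed.

(** The value at t = 0 is the limit provided by Taylor's formula. *)
Definition taylor_quot k F p : R :=
  if p.2 == 0 then iter_D k F p.1 / k`!%:R else taylor_rem k F p / p.2 ^+ k.

Lemma taylor_quot0E F p : taylor_quot 0 F p = F (slide p).
Proof.
rewrite /taylor_quot; case: eqVneq => [p0|_]; last by rewrite /= expr0 divr1.
by rewrite /slide p0 scale0r addr0 divr1.
Qed.

(** This identity exhibits T_k F, near t = 0, as the sum of a smooth function
    and of t times a function that is continuous at t = 0. *)
Lemma taylor_quotS k F p :
  taylor_quot k F p = iter_D k F p.1 / k`!%:R + p.2 * taylor_quot k.+1 F p.
Proof.
rewrite /taylor_quot; case: eqVneq => [->|p0]; first by rewrite mul0r addr0.
have k0 : (k`!%:R : R) != 0 by rewrite pnatr_eq0 -lt0n fact_gt0.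
by rewrite /= exprS; field; rewrite k0 p0 expf_neq0.
Qed.

Lemma taylor_quot_cont k F x : smooth_on D F -> D x ->
  {for (x, 0 : R), continuous (taylor_quot k F)}.
Proof.
move=> Fs Dx; apply/cvgrPdist_le => e e0.
have -> : taylor_quot k F (x, 0) = iter_D k F x / k`!%:R.
  by rewrite /taylor_quot eqxx.
have cD : {for (x, 0 : R), continuous (fun p => iter_D k F p.1 / k`!%:R)}.
  apply: continuousM; last exact: cst_continuous.
  apply: continuous_comp; first exact: cvg_fst.
  exact: differentiable_continuous (smooth_on_diff (iter_D_smooth k Fs) Dx).
move/cvgrPdist_le : cD => /(_ e e0) cD; near=> p.
rewrite /taylor_quot; case: eqVneq => p0; first by near: p.
rewrite distrC -(mulfK (expf_neq0 k p0) (iter_D k F x / k`!%:R)) -mulrBl normrM.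
rewrite normfV normrX ler_pdivrMr ?exprn_gt0 ?normr_gt0//.
by near: p; exact: taylor_rem_approx.
Unshelve. all: by end_near. Qed.

(** The right-hand side is again built from Taylor quotients.  At t = 0 this
    comes from [taylor_quotS] and [is_diff_mul_eq0]; elsewhere it is the
    quotient rule, with [is_diff_taylor_rem]. *)
Lemma is_diff_taylor_quot k F p : smooth_on D F -> slide_dom p ->
  is_diff p (taylor_quot k F) (fun q =>
    taylor_quot k (fun y => 'D_(q.1) F y) p +
    q.2 * (taylor_quot k (fun y => 'D_w F y) p - k%:R * taylor_quot k.+1 F p)).
Proof.
move=> Fs Op; have [p0|p0] := eqVneq p.2 0.
  case: p p0 Op => x _ /= -> [/= Dx _].
  have -> : taylor_quot k F =
      fun p => iter_D k F p.1 / k`!%:R + p.2 * taylor_quot k.+1 F p.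
    by apply/funext => p; exact: taylor_quotS.
  have dF := smooth_on_diff (iter_D_smooth k Fs) Dx.
  have H1 := is_diff_comp (is_diff_fst (x, 0 : R)) (differentiableP dF).
  have H2 := is_diff_mulc k`!%:R^-1 H1.
  have [ds dsE] := is_diff_snd (x, 0 : R).
  have H3 := is_diff_mul_eq0 ds erefl (@taylor_quot_cont k.+1 F x Fs Dx).
  apply: is_diff_eq (is_diff_add H2 H3) _; apply/funext => q.
  rewrite dsE /= /taylor_quot eqxx /= -!derive_iter_D// ?deriveE//; last first.
  rewrite factS natrM /=.
  have k0 : (k`!%:R : R) != 0 by rewrite pnatr_eq0 -lt0n fact_gt0.
  by field; rewrite k0 nat1r pnatr_eq0.
case: k => [|k].
  have -> : taylor_quot 0 F = taylor_rem 0 F.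
    by apply/funext => q; exact: taylor_quot0E.
  apply: is_diff_eq (is_diff_taylor_rem0 Fs Op) _; apply/funext => q.
  by rewrite !taylor_quot0E mul0r subr0.
have p0k : p.2 ^+ k.+1 != 0 by rewrite expf_neq0.
have H1 := @is_diff_inv _ _ (fun p : V * R => p.2 ^+ k.+1) _ p p0k
                        (is_diff_snd_exp k.+1 p).
have H2 := is_diff_mul (is_diff_taylor_rem k Fs Op) H1.
apply: (@is_diff_near _ _
   (fun p => taylor_rem k.+1 F p * (p.2 ^+ k.+1)^-1)); last first.
  apply: is_diff_eq H2 _; apply/funext => q.
  rewrite /taylor_quot (negbTE p0) /= -iter_DS factS natrM.
  have k0 : (k`!%:R : R) != 0 by rewrite pnatr_eq0 -lt0n fact_gt0.
  rewrite /= !exprS; field.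
  by rewrite k0 nat1r pnatr_eq0 p0 expf_neq0.
have : \forall q \near p, q.2 != 0.
  apply: (open_nbhs_nbhs (A := [set q : V * R | q.2 != 0])); split=> //.
  apply: (open_comp (f := snd) (D := [set r : R | r != 0])).
    by move=> q _; exact: cvg_snd.
  exact: open_neq.
by apply: filterS => q q0; rewrite /taylor_quot (negbTE q0).
Qed.

Lemma taylor_quot_smooth k F : smooth_on D F ->
  smooth_on slide_dom (taylor_quot k F).
Proof.
move=> Fs; apply/smooth_onP => m.
elim: m k F Fs => [|m IH] k F Fs.
  exact: Ck0_intro (fun p => @is_diff_taylor_quot k F p Fs).
apply: (Ck_intro slide_dom_open (fun p => @is_diff_taylor_quot k F p Fs)).
move=> q; have Fs' v := smooth_on_derive v Fs.
apply: (CkD slide_dom_open (IH k _ (Fs' q.1))).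
apply: (CkM slide_dom_open (Ck_cst _ _ q.2)).
apply: (CkD slide_dom_open (IH k _ (Fs' w))).
have := CkM slide_dom_open (Ck_cst m slide_dom (- k%:R)) (IH k.+1 _ Fs).
apply: Ck_eq => [|p _]; [exact: slide_dom_open|].
by rewrite mulNr.
Qed.

End taylor_quotient.

(** * The zero set as a graph over the other directions *)

Section implicit_function.
Context {R : realType} {V : normedModType R}.
Implicit Types (D B U : set V) (F G : V -> R) (x y v w : V).

Lemma ball_line_convex x y w (r a b t : R) : a <= t <= b ->
  ball x r (y + a *: w) -> ball x r (y + b *: w) -> ball x r (y + t *: w).
Proof.
move=> /andP[at_ tb]; have [ab|] := ltP a b; last first.
  move=> ba; have -> : t = a by apply/le_anti; rewrite at_ (le_trans tb ba).
  by [].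
rewrite -ball_normE /= => xa xb.
have ba0 : 0 < b - a by rewrite subr_gt0.
have [s [s0 s1 tE]] :
    exists s, [/\ 0 <= s, 0 <= 1 - s & t = (1 - s) * a + s * b].
  exists ((t - a) / (b - a)); split; last by field; rewrite gt_eqF.
    by rewrite divr_ge0 ?subr_ge0// ltW.
  by rewrite subr_ge0 ler_pdivrMr// mul1r lerB.
have -> : x - (y + t *: w) =
    (1 - s) *: (x - (y + a *: w)) + s *: (x - (y + b *: w)).
  have E p : x - (y + p *: w) = (x - y) - p *: w by rewrite opprD addrA.
  rewrite !E; move: (x - y) => u; rewrite !scalerBr !scalerA.
  rewrite addrACA -opprD -!scalerDl subrK scale1r.
  by rewrite -tE.
rewrite (le_lt_trans (ler_normD _ _))// !normrZ !ger0_norm//.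
have [s0'|s0'] := eqVneq s 0; first by rewrite s0' mul0r subr0 mul1r addr0.
have -> : r = (1 - s) * r + s * r by ring.
rewrite ler_ltD//.
  by rewrite ler_wpM2l// ltW.
by rewrite ltr_pM2l// lt0r s0'.
Qed.

Lemma slide_taylor1 w F p : F (slide w p) = F p.1 + p.2 * taylor_quot w 1 F p.
Proof. by rewrite -taylor_quot0E taylor_quotS divr1. Qed.

(** The first Taylor quotient is a value of D_w G on the segment between the two
    points, by the mean value theorem. *)
Lemma taylor_quot1_ge w G x (r c : R) y s :
  smooth_on (ball x r) G -> (forall z, ball x r z -> c <= 'D_w G z) ->
  ball x r y -> ball x r (y + s *: w) -> c <= taylor_quot w 1 G (y, s).
Proof.
move=> Gs Gc By Bys.
have Bl (q : R) : 0 <= q <= 1 -> ball x r (y + (q * s) *: w).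
  move=> qI; rewrite -scalerA; apply: (@ball_line_convex _ _ _ _ 0 1) => //.
    by rewrite scale0r addr0.
  by rewrite scale1r.
rewrite /taylor_quot /=; case: eqVneq => [s0|s0].
  by rewrite divr1; exact: Gc.
have [|q qI E] := @mvt_ray _ _ G y w s.
  by move=> q /Bl; exact: smooth_on_diff.
rewrite expr0 expr1 divr1 mul1r {1}/slide /= E mulrC mulKf//.
exact/Gc/Bl.
Qed.

Lemma zero_on_line w G x (r a : R) y : 0 <= a ->
  smooth_on (ball x r) G ->
  ball x r (y - a *: w) -> ball x r (y + a *: w) ->
  G (y - a *: w) <= 0 <= G (y + a *: w) ->
  exists2 t, ball x r (y + t *: w) & G (y + t *: w) = 0.
Proof.
move=> a0 Gs Bm Bp /andP[Gm Gp].
have Bl (t : R) : - a <= t <= a -> ball x r (y + t *: w).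
  by move=> tI; apply: ball_line_convex tI _ Bp; rewrite scaleNr.
have aa : - a <= a by rewrite ge0_cp.
have [||t tI Gt] := @IVT R (fun t => G (y + t *: w)) (- a) a 0 aa.
- apply: continuous_in_subspaceT => t; rewrite inE /= in_itv /= => tI.
  apply: continuous_comp.
    apply: continuousD; first exact: cst_continuous.
    exact: scalel_continuous.
  exact/differentiable_continuous/(smooth_on_diff Gs)/Bl.
- by rewrite scaleNr ge_min le_max Gm Gp orbT.
- by exists t => //; apply: Bl; move: tI; rewrite in_itv.
Qed.

(** Fix [y], let q be the zero on its line, and s(z) = tau(z) - tau(y).  Since
    G vanishes at z + tau(z) w, which is z + tau(y) w moved by s(z) w,
      0 = G(z + tau(y) w) + s(z) T_1 G (z + tau(y) w, s(z)),
    and T_1 G >= c > 0.  Hence s is continuous at [y]; then it is the product of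
    G(z + tau(y) w), which is differentiable and vanishes at z = y, by the
    continuous factor -1 / T_1 G, and [is_diff_mul_eq0] applies. *)
Lemma is_diff_implicit w G x (r c : R) U (tau : V -> R) y :
  0 < c -> open U -> U `<=` ball x r -> smooth_on (ball x r) G ->
  (forall z, ball x r z -> c <= 'D_w G z) ->
  (forall y, U y -> ball x r (y + tau y *: w) /\ G (y + tau y *: w) = 0) ->
  U y -> is_diff y tau (fun v =>
    - ('D_v G (y + tau y *: w) / 'D_w G (y + tau y *: w))).
Proof.
move=> c0 Uo UB Gs Gc tauP Uy.
pose q := y + tau y *: w; have [Bq Gq] := tauP y Uy; rewrite -/q in Bq Gq *.
have Bo : open (ball x r) by exact: ball_open.
pose sh z := z + tau y *: w.
have dsh : is_diff y sh id.
  have H := is_diffD (is_diff_id y) (is_diff_cst (tau y *: w) y).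
  by apply: is_diff_eq H _; apply/funext => v; rewrite fctE addr0.
have dGq := smooth_on_diff Gs Bq.
have dg : is_diff y (G \o sh) ('d G q) by exact: is_diff_comp.
pose s z := tau z - tau y.
have nU : \near y, U y /\ ball x r (sh y).
  apply: filterI; first exact: open_nbhs_nbhs.
  have [dshy _] := dsh.
  apply: (differentiable_continuous dshy); exact: open_nbhs_nbhs.
have Es z : U z -> G (sh z) + s z * taylor_quot w 1 G (sh z, s z) = 0.
  move=> /tauP[_]; have := slide_taylor1 w G (sh z, s z); rewrite /= => <-.
  by rewrite /slide/= /sh /s -addrA -scalerDl subrKC.
have Tc z : U z -> ball x r (sh z) -> c <= taylor_quot w 1 G (sh z, s z).
  move=> /tauP[Bz _] Bsz; apply: taylor_quot1_ge Gs Gc Bsz _.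
  by rewrite /sh /s -addrA -scalerDl subrKC.
have s0 : s y = 0 by rewrite /s subrr.
(* By [Es] and [Tc], c |s z| is bounded by |G (sh z)|, which tends to 0. *)
have cs : {for y, continuous s}.
  apply/cvgrPdist_le => e e0; rewrite s0.
  have cg : {for y, continuous (G \o sh)}.
    by have [? _] := dg; exact: differentiable_continuous.
  move/cvgrPdist_le : cg => /(_ (c * e) (mulr_gt0 c0 e0)).
  apply: filterS2 nU => z [Uz Bz] /=; rewrite Gq !sub0r !normrN => gz.
  rewrite -(ler_pM2l c0) (le_trans _ gz)//.
  have /eqP := Es z Uz; rewrite addr_eq0 => /eqP ->.
  have T0 := Tc z Uz Bz.
  rewrite normrN normrM mulrC ler_wpM2l//.
  by rewrite ger0_norm ?(le_trans (ltW c0)).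
pose rho z := - (taylor_quot w 1 G (sh z, s z))^-1.
have Tq : taylor_quot w 1 G (q, 0) = 'D_w G q.
  by rewrite /taylor_quot eqxx /= divr1.
have Dq0 : 'D_w G q != 0 by rewrite gt_eqF// (lt_le_trans c0)// Gc.
have crho : {for y, continuous rho}.
  apply: continuousN; apply: continuousV; first by rewrite s0 Tq.
  apply: (@continuous2_cvg _ _ _ _ _ _ sh s
    (fun p t => taylor_quot w 1 G (p, t)) (sh y) (s y)) => //.
    rewrite s0 (_ : (fun z => _) = taylor_quot w 1 G); last first.
      by apply/funext => -[].
    exact: (taylor_quot_cont Bo Gs Bq).
  by have [dshy _] := dsh; exact: (differentiable_continuous dshy).
have [dgy dgE] := dg.
have H := is_diffD (is_diff_cst (tau y) y) (is_diff_mul_eq0 dgy Gq crho).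
apply: (is_diff_near _ (is_diff_eq H _)); last first.
  apply/funext => v; rewrite fctE [X in X + _]/(0 : R) add0r dgE.
  rewrite -(deriveE _ dGq) /rho.
  have -> : taylor_quot w 1 G (sh y, s y) = 'D_w G q by rewrite s0.
  by rewrite mulNr mulrC.
apply: filterS nU => z [Uz Bz]; rewrite fctE /=.
have T0 := lt_le_trans c0 (Tc z Uz Bz).
have /eqP := Es z Uz; rewrite addr_eq0 => /eqP ->.
by rewrite /rho mulrNN mulfK ?gt_eqF// /s subrKC.
Qed.

End implicit_function.

(** * Dividing a smooth function by another *)

Section division.
Context {R : realType} {V : normedModType R}.
Implicit Types (D B U : set V) (F G : V -> R) (x y v w : V).

(** By the chain rule the derivative in direction v is g(y, tau(y)) with
    g = D_(v, 0) f - (D_v G / D_w G) (y + t w) D_(0, 1) f, again smooth; so all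
    orders follow by induction over all [f] at once. *)
Lemma Ck_implicit_comp w G x (r c : R) U (tau : V -> R) :
  0 < c -> open U -> U `<=` ball x r -> smooth_on (ball x r) G ->
  (forall z, ball x r z -> c <= 'D_w G z) ->
  (forall y, U y -> ball x r (y + tau y *: w) /\ G (y + tau y *: w) = 0) ->
  forall k (f : V * R -> R), smooth_on (slide_dom (ball x r) w) f ->
  Ck k U (fun y => f (y, tau y)).
Proof.
move=> c0 Uo UB Gs Gc tauP.
have Bo : open (ball x r) by exact: ball_open.
have Oo := slide_dom_open (w := w) Bo.
have UO y : U y -> slide_dom (ball x r) w (y, tau y).
  by move=> Uy; split; [exact: UB|case: (tauP y Uy)].
have dtau := is_diff_implicit c0 Uo UB Gs Gc tauP.
have df f y : smooth_on (slide_dom (ball x r) w) f -> U y ->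
    is_diff y (fun y => f (y, tau y)) (fun v =>
      'd f (y, tau y) (v, 0) + - ('D_v G (y + tau y *: w) /
         'D_w G (y + tau y *: w)) * 'd f (y, tau y) (0, 1)).
  move=> fs Uy; have dfy := smooth_on_diff fs (UO y Uy).
  have H := is_diff_comp (is_diff_pair (is_diff_id y) (dtau y Uy))
                         (differentiableP dfy).
  apply: is_diff_eq H _; apply/funext => v /=.
  rewrite -[RHS]/('d f (y, tau y) (v, 0) + _ *: 'd f (y, tau y) (0, 1)).
  rewrite -linearZ -linearD; congr ('d _ _ _).
  rewrite -[RHS]/(v + _ *: (0 : V), 0 + _ * 1).
  by rewrite scaler0 addr0 add0r mulr1.
elim=> [|k IH] f fs; first exact: Ck0_intro (fun y => @df f y fs).
apply: (Ck_intro Uo (fun y => @df f y fs)) => v.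
pose g (p : V * R) := 'D_(v, 0) f p + - ('D_v G (slide w p) /
                         'D_w G (slide w p)) * 'D_(0, 1) f p.
have gs : smooth_on (slide_dom (ball x r) w) g.
  apply/smooth_onP => m.
  have fC u : Ck m (slide_dom (ball x r) w) (fun p => 'D_u f p).
    by have /smooth_onP := smooth_on_derive u fs; apply.
  have GC u : Ck m (slide_dom (ball x r) w) (fun p => 'D_u G (slide w p)).
    have /smooth_onP/(_ m) :=
      @taylor_quot_smooth _ _ _ w Bo 0 _ (smooth_on_derive u Gs).
    by apply: Ck_eq => [//|p _]; rewrite taylor_quot0E.
  have GV : Ck m (slide_dom (ball x r) w) (fun p => ('D_w G (slide w p))^-1).
    apply: CkV (GC w) => // p [_ Bp].
    by rewrite gt_eqF// (lt_le_trans c0)// Gc.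
  apply: (CkD Oo (fC _)).
  have H := CkM Oo (Ck_cst m _ (-1)) (CkM Oo (CkM Oo (GC v) GV) (fC (0, 1))).
  by apply: (Ck_eq Oo _ H) => p _; rewrite mulN1r mulNr.
apply: (Ck_eq Uo _ (IH g gs)) => y Uy.
by have dfy := smooth_on_diff fs (UO y Uy); rewrite /g !(deriveE _ dfy).
Qed.

(** Moving from x by -a w or a w makes G negative or positive, and this
    persists for the points near x; [tau] is then given by the intermediate
    value theorem. *)
Lemma implicit_line w G x (r c : R) : 0 < r -> 0 < c ->
  smooth_on (ball x r) G -> (forall z, ball x r z -> c <= 'D_w G z) ->
  G x = 0 -> exists2 U, open_nbhs x U & U `<=` ball x r /\
    exists tau : V -> R, forall y, U y ->
      ball x r (y + tau y *: w) /\ G (y + tau y *: w) = 0.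
Proof.
move=> r0 c0 Gs Gc Gx.
have Bo : open (ball x r) by exact: ball_open.
have Bx : ball x r x by exact: ballxx.
have [a a0 aB] := open_box w 0 Bo Bx.
have Bp : ball x r (x + a *: w).
  have := aB a 0; rewrite scaler0 addr0 normr0 gtr0_norm//; apply=> //.
  exact: ltW.
have Bm : ball x r (x - a *: w).
  have := aB (- a) 0; rewrite scaler0 addr0 normr0 normrN gtr0_norm// scaleNr.
  by apply=> //; exact: ltW.
have Gp : 0 < G (x + a *: w).
  have := slide_taylor1 w G (x, a); rewrite /slide /= Gx add0r => ->.
  by rewrite mulr_gt0// (lt_le_trans c0)// (taylor_quot1_ge Gs Gc).
have Gm : G (x - a *: w) < 0.
  have := slide_taylor1 w G (x, - a); rewrite /slide /= Gx add0r scaleNr => ->.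
  rewrite mulNr oppr_lt0 mulr_gt0// (lt_le_trans c0)//.
  by apply: (taylor_quot1_ge Gs Gc) => //; rewrite scaleNr.
have cont_shift (u : V) (P : set V) : nbhs (x + u) P -> \near x, P (x + u).
  have H : {for x, continuous (fun z => z + u)}.
    by apply: continuousD; [exact: cvg_id|exact: cst_continuous].
  by move/H.
have nG u (P : set R) : ball x r (x + u) -> nbhs (G (x + u)) P ->
    \near x, P (G (x + u)).
  move=> Bu /(differentiable_continuous (smooth_on_diff Gs Bu)) GP.
  exact: (cont_shift u (G @^-1` P)).
have : nbhs x [set y | [/\ ball x r y, ball x r (y + a *: w),
    ball x r (y - a *: w), 0 < G (y + a *: w) & G (y - a *: w) < 0]].
  near=> y; split; near: y.
  - exact: open_nbhs_nbhs.
  - exact/cont_shift/open_nbhs_nbhs.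
  - exact/cont_shift/open_nbhs_nbhs.
  - by apply: (nG _ [set t | 0 < t]) => //; exact: lt_nbhsr.
  - by apply: (nG _ [set t | t < 0]) => //; exact: lt_nbhsl.
rewrite nbhsE => -[U Ux UP]; exists U => //; split; first by move=> y /UP[].
exists (fun y => xget 0
  [set t : R | ball x r (y + t *: w) /\ G (y + t *: w) = 0]).
move=> y /UP[By Byp Bym Gyp Gym].
have [|t Bt Gt] := zero_on_line (ltW a0) Gs Bym Byp; first by rewrite !ltW.
exact: (@xgetPex _ 0 [set t : R | ball x r (y + t *: w) /\ G (y + t *: w) = 0]
          (ex_intro _ t (conj Bt Gt))).
Unshelve. all: by end_near. Qed.

Lemma local_quotient_pos D w F G x : open D -> smooth_on D F -> smooth_on D G ->
  (forall y, D y -> G y = 0 -> F y = 0) ->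
  D x -> G x = 0 -> 0 < 'D_w G x ->
  exists2 U, open_nbhs x U & U `<=` D /\
    exists2 m : V -> R, smooth_on U m & forall y, U y -> F y = m y * G y.
Proof.
move=> Do Fs Gs FG Dx Gx Gw.
(* Half the value at x: by continuity, D_w G stays above c on a ball. *)
pose c := 'D_w G x / 2.
have c0 : 0 < c by rewrite divr_gt0.
have : nbhs x (D `&` [set y | c < 'D_w G y]).
  apply: filterI; first exact: open_nbhs_nbhs.
  have cG : {for x, continuous (fun y => 'D_w G y)}.
    apply: differentiable_continuous.
    exact: smooth_on_diff (smooth_on_derive w Gs) Dx.
  apply: (cG [set t | c < t]); apply: lt_nbhsr.
  by rewrite ltr_pdivrMr// ltr_pMr// ltr1n.
move=> /nbhs_ballP[r /= r0 rP].
have BD : ball x r `<=` D by move=> y /rP[].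
have Gc z : ball x r z -> c <= 'D_w G z by move=> /rP[_ /ltW].
have {}Gs := smooth_on_sub BD Gs; have {}Fs := smooth_on_sub BD Fs.
have [U Ux [UB [tau tauP]]] := implicit_line r0 c0 Gs Gc Gx.
exists U => //; split; first exact: subset_trans UB BD.
have Uo := Ux.1.
have Bo : open (ball x r) by exact: ball_open.
have Oo := slide_dom_open (w := w) Bo.
have T0 p : slide_dom (ball x r) w p -> taylor_quot w 1 G p != 0.
  case: p => y t [/= By Bt].
  by rewrite gt_eqF// (lt_le_trans c0)// (taylor_quot1_ge Gs Gc).
pose f p := taylor_quot w 1 F p / taylor_quot w 1 G p.
have fs : smooth_on (slide_dom (ball x r) w) f.
  apply/smooth_onP => m.
  have /smooth_onP FC := @taylor_quot_smooth _ _ _ w Bo 1 _ Fs.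
  have /smooth_onP GC := @taylor_quot_smooth _ _ _ w Bo 1 _ Gs.
  exact: CkM Oo (FC m) (CkV Oo T0 (GC m)).
exists (fun y => f (y, tau y)).
  apply/smooth_onP => k.
  exact: (Ck_implicit_comp c0 Uo UB Gs Gc tauP).
move=> y Uy; have [Bt Gt] := tauP y Uy.
have := slide_taylor1 w F (y, tau y); rewrite /slide /= FG//; last exact: BD.
have := slide_taylor1 w G (y, tau y); rewrite /slide /= Gt.
move=> /esym/eqP; rewrite addr_eq0 => /eqP ->.
move=> /esym/eqP; rewrite addr_eq0 => /eqP ->.
rewrite /f; field.
by apply: T0; split => //; exact: UB.
Qed.

Lemma local_quotient D w F G x : open D -> smooth_on D F -> smooth_on D G ->
  (forall y, D y -> G y = 0 -> F y = 0) ->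
  D x -> G x = 0 -> 'D_w G x != 0 ->
  exists2 U, open_nbhs x U & U `<=` D /\
    exists2 m : V -> R, smooth_on U m & forall y, U y -> F y = m y * G y.
Proof.
move=> Do Fs Gs FG Dx Gx; rewrite neq_lt => /orP[Gw|]; last first.
  exact: local_quotient_pos Fs Gs FG Dx Gx.
apply: (@local_quotient_pos D (- w)) => //.
have dG := smooth_on_diff Gs Dx.
by move: Gw; rewrite !deriveE// linearN oppr_gt0.
Qed.

End division.

(** * The fundamental tensor in charts *)

Section finsler.
Context {R : realType} {n : nat} {M : manifold R n}.
Local Notation V := 'rV[R]_n.
Local Notation TM := (tangent_bundle M).
Local Notation dom i := (cdom (mchart i)).
Implicit Types (A : set TM) (L mu : TM -> R) (v : TM) (i : cindex M).

Definition chart_dom A i : set (V * V) := tchart i @` (A `&` tdom i).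

Lemma chart_domP A i z : chart_dom A i z ->
  [/\ A (tchart_inv i z), dom i (tproj (tchart_inv i z)) &
      tchart i (tchart_inv i z) = z].
Proof. by move=> [v [Av iv] <-]; rewrite tchartK. Qed.

Lemma component_comb p (a b : R) (u w : tangent p) i :
  component (a *: u + b *: w) i = a *: component u i + b *: component w i.
Proof. by rewrite -[component _]/(val _) linearD !linearZ. Qed.

Lemma tchart_comb v (w : tangent (tproj v)) (a b : R) i :
  tchart i (tpoint (a *: tvect v + b *: w)) =
  ((tchart i v).1, a *: (tchart i v).2 + b *: component w i).
Proof. by rewrite /tchart component_comb. Qed.

Lemma tchart_line v (w : tangent (tproj v)) (s : R) i :
  tchart i (tpoint (tvect v + s *: w)) =
  tchart i v + s *: (0 : V, component w i).
Proof.
rewrite -[tvect v]scale1r tchart_comb scale1r.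
rewrite -[RHS]/((tchart i v).1 + s *: (0 : V),
                (tchart i v).2 + s *: component w i).
by rewrite scaler0 addr0.
Qed.

Lemma conic_line A v (w : tangent (tproj v)) : conic_open A -> A v ->
  \forall s \near (0 : R), A (tpoint (tvect v + s *: w)).
Proof.
move=> [Ao _ _ _] Av; have [i iv] := mchart_cover (tproj v).
have [|d d0 dA] := open_box (0, component w i) 0 (Ao i) (x := tchart i v).
  by exists v.
apply/nbhs_ballP; exists d => //= s; rewrite /ball /= sub0r normrN => sd.
have := dA s 0 (ltW sd); rewrite normr0 (ltW d0) scaler0 addr0 => /(_ isT).
rewrite -tchart_line => /chart_domP[+ _ _].
by rewrite tchartK.
Qed.

Lemma vertical_derivative A L v (w : tangent (tproj v)) i :
  tsmooth A L -> A v -> dom i (tproj v) ->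
  is_diff (0 : R) (fun s => L (tpoint (tvect v + s *: w)))
    (fun s => s * 'D_(0, component w i) (L \o tchart_inv i : _ -> R)
                    (tchart i v)).
Proof.
move=> Ls Av iv; set u := (0, component w i).
have Ez : chart_dom A i (tchart i v) by exists v.
have dL := smooth_on_diff (Ls i) Ez.
have dl : is_diff (0 : R) (fun s : R => tchart i v + s *: u) (fun r => r *: u).
  have H := is_diffD (is_diff_cst (tchart i v) (0 : R)) (is_diff_scalel 0 u).
  by apply: is_diff_eq H _; apply/funext => r /=; rewrite fctE add0r.
have -> : (fun s => L (tpoint (tvect v + s *: w))) =
          (L \o tchart_inv i) \o (fun s : R => tchart i v + s *: u).
  by apply/funext => s /=; rewrite -tchart_line tchartK.
have dL' : differentiable (L \o tchart_inv i : _ -> R) (tchart i v + 0 *: u).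
  by rewrite scale0r addr0.
apply: is_diff_eq (is_diff_comp dl (differentiableP dL')) _.
by apply/funext => r /=; rewrite scale0r addr0 linearZ deriveE.
Qed.

(** For a = 1 + t > 0, L(a v + s w) = a^2 L(v + (s / a) w), so the inner
    derivative is a times its value for t = 0. *)
Lemma fundamental_tensorE A L v (w : tangent (tproj v)) i :
  conic_open A -> pseudo_Finsler A L -> A v -> dom i (tproj v) ->
  fundamental_tensor L v (tvect v) w =
  2^-1 * 'D_(0, component w i) (L \o tchart_inv i : _ -> R) (tchart i v).
Proof.
move=> Ac [Ls Lh _] Av iv; rewrite /fundamental_tensor; congr (_ * _).
set d := 'D_ _ _ _.
have dl := vertical_derivative w Ls Av iv; rewrite -/d in dl.
pose l (s : R) := L (tpoint (tvect v + s *: w)).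
have dla (a : R) : 0 < a ->
    derive1 (fun s : R => L (tpoint (a *: tvect v + s *: w)) : R^o) 0 = a * d.
  move=> a0.
  have H : is_diff (0 : R)
      (fun s => a ^+ 2 * l (a^-1 * s)) (fun s => a * d * s).
    have dl0 : is_diff (a^-1 * 0) l (fun s => s * d) by rewrite mulr0.
    have H := is_diffZ (a ^+ 2)
                (is_diff_comp (is_diff_scaler a^-1 (0 : R)) dl0).
    apply: is_diff_eq H _; apply/funext => s.
    rewrite -[LHS]/(a ^+ 2 * (a^-1 * s * d)); field.
    by rewrite gt_eqF.
  rewrite derive1E -[RHS]mulr1 -(is_diff_derive (1 : R^o) H).
  apply: near_eq_derive.
  have nA : \forall s \near (0 : R), A (tpoint (tvect v + (a^-1 * s) *: w)).
    have c0 : {for (0 : R), continuous (fun s : R => a^-1 * s)}.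
      by apply: continuousM; [exact: cst_continuous|exact: cvg_id].
    apply: (c0 [set r | A (tpoint (tvect v + r *: w))]).
    by rewrite mulr0; exact: conic_line.
  apply: filterS nA => s As; rewrite /l -Lh//; congr (L (tpoint _)).
  by rewrite /tvect /= scalerDr scalerA mulVKf// gt_eqF.
have H : is_diff (0 : R) (fun t => d * (1 + t)) (fun s => d * s).
  have H := is_diffZ d (is_diffD (is_diff_cst (1 : R) (0 : R)) (is_diff_id 0)).
  by apply: is_diff_eq H _; apply/funext => s; rewrite fctE /= fctE /= add0r.
rewrite derive1E -[RHS]mulr1 -(is_diff_derive (1 : R^o) H).
apply: near_eq_derive.
have : \forall t \near (0 : R), -1 < t by apply: lt_nbhsr; rewrite ltrN10.
apply: filterS => t t1; rewrite -{1}[tvect v]scale1r -scalerDl dla 1?mulrC//.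
by rewrite -ltrBlDl sub0r.
Qed.

(** Euler's identity: L(v + s c v) = (1 + s c)^2 L(v). *)
Lemma fundamental_tensor_radial A L v (c : R) :
  conic_open A -> pseudo_Finsler A L -> A v ->
  fundamental_tensor L v (tvect v) (c *: tvect v) = c * L v.
Proof.
move=> Ac PF Av; have [i iv] := mchart_cover (tproj v).
have [Ls Lh _] := PF.
rewrite (fundamental_tensorE _ Ac PF Av iv).
have dl := vertical_derivative (c *: tvect v) Ls Av iv.
set d := 'D_ _ _ _ in dl *.
have dE : d = 'D_1 (fun s : R => L (tpoint (tvect v + s *: (c *: tvect v)))) 0.
  by rewrite (is_diff_derive _ dl) mul1r.
have H : is_diff (0 : R) (fun s => L v * (1 + c * s) ^+ 2)
    (fun s => L v * (2 * c) * s).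
  have H1 := is_diffD (is_diff_cst (1 : R) (0 : R)) (is_diff_scaler c (0 : R)).
  have H2 := is_diffZ (L v) (is_diff_mul H1 H1).
  apply: is_diff_eq H2 _; apply/funext => s.
  rewrite -[LHS]/(L v * ((1 + c * 0) * (0 + c * s) +
                         (1 + c * 0) * (0 + c * s))).
  by ring.
have -> : d = L v * (2 * c) * 1.
  rewrite dE -(is_diff_derive (1 : R^o) H); apply: near_eq_derive.
  have : \forall s \near (0 : R), 0 < 1 + c * s.
    have c0 : {for (0 : R), continuous (fun s : R => 1 + c * s)}.
      apply: continuousD; first exact: cst_continuous.
      by apply: continuousM; [exact: cst_continuous|exact: cvg_id].
    by apply: (c0 [set r | 0 < r]); apply: lt_nbhsr; rewrite mulr0 addr0.
  apply: filterS => s s0.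
  rewrite mulrC -Lh//; congr (L (tpoint _)).
  by rewrite scalerDl scale1r scalerA mulrC.
by field.
Qed.

Lemma fundamental_tensor_neq0 A L v : conic_open A -> pseudo_Finsler A L ->
  A v -> exists w, fundamental_tensor L v (tvect v) w != 0.
Proof.
move=> [_ A0 _ _] [_ _ nd] Av; apply/not_existsP => H.
apply: (A0 v Av); apply: (nd v Av) => w.
by have /negP := H w; rewrite negbK => /eqP.
Qed.

Lemma derive_factor (E : normedModType R) (U : set E) (F G m : E -> R) y u :
  open_nbhs y U -> (forall y, U y -> F y = m y * G y) ->
  differentiable m y -> differentiable G y ->
  'D_u F y = m y * 'D_u G y + G y * 'D_u m y.
Proof.
move=> Uy FE dm dG.
rewrite (deriveE _ dG) (deriveE _ dm).
have dmG := is_diff_mul (differentiableP dm) (differentiableP dG).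
rewrite -(is_diff_derive u dmG).
by apply: near_eq_derive; apply: filterS (open_nbhs_nbhs Uy).
Qed.

End finsler.

(** * The factor of anisotropy *)

Section anisotropy.
Context {R : realType} {n : nat} {M : manifold R n}.
Local Notation V := 'rV[R]_n.
Local Notation TM := (tangent_bundle M).
Local Notation dom i := (cdom (mchart i)).
Context (A : set TM) (L1 L2 : TM -> R) (Ac : conic_open A)
  (PF1 : pseudo_Finsler A L1) (PF2 : pseudo_Finsler A L2).
Implicit Types (v : TM) (i : cindex M).

Lemma anisotropy_factor_formula mu v : anisotropy_factor A L1 L2 mu -> A v ->
  (L1 v != 0 -> mu v = L2 v / L1 v) /\
  (forall w : tangent (tproj v),
     (L1 v = 0 \/ exists c : R, w = c *: tvect v) ->
     fundamental_tensor L1 v (tvect v) w != 0 ->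
     fundamental_tensor L2 v (tvect v) w != 0 /\
     mu v = fundamental_tensor L2 v (tvect v) w /
            fundamental_tensor L1 v (tvect v) w).
Proof.
move=> [mus mu0 L2E] Av; split; first by move=> L10; rewrite L2E// mulfK.
move=> w H g10.
suff E : fundamental_tensor L2 v (tvect v) w =
         mu v * fundamental_tensor L1 v (tvect v) w.
  by rewrite E mulfK// mulf_neq0// mu0.
case: H => [L10|[c ->]]; last first.
  by rewrite !(@fundamental_tensor_radial _ _ _ A)// L2E// mulrCA.
have [i iv] := mchart_cover (tproj v).
have [L1s _ _] := PF1.
rewrite (fundamental_tensorE w Ac PF1 Av iv).
rewrite (fundamental_tensorE w Ac PF2 Av iv).
have Ez : chart_dom A i (tchart i v) by exists v.
have Eo : open (chart_dom A i) by have [Ao _ _ _] := Ac; exact: Ao.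
rewrite (@derive_factor _ _ (chart_dom A i) _
          (L1 \o tchart_inv i : _ -> R) (mu \o tchart_inv i : _ -> R)).
- by rewrite /= tchartK// L10 mul0r addr0 mulrCA.
- by [].
- by move=> z /chart_domP[Az _ _]; exact: L2E.
- exact: smooth_on_diff (mus i) Ez.
- exact: smooth_on_diff (L1s i) Ez.
Qed.

(** On the lightcone, the default value of [xget] is never taken, because L1 is
    nondegenerate. *)
Definition quotient_factor v : R :=
  if L1 v == 0 then
    let w := xget 0 [set w | fundamental_tensor L1 v (tvect v) w != 0] in
    fundamental_tensor L2 v (tvect v) w / fundamental_tensor L1 v (tvect v) w
  else L2 v / L1 v.

Context (zero12 : forall v, A v -> L1 v = 0 -> L2 v = 0).

(** Off the lightcone [m] is the quotient of the metrics.  At a point of the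
    lightcone it comes from [local_quotient], and agrees with
    [quotient_factor] at the neighbouring null vectors by [derive_factor]. *)
Lemma quotient_factor_local i z : chart_dom A i z ->
  exists2 U, open_nbhs z U & U `<=` chart_dom A i /\
    exists2 m : V * V -> R, smooth_on U m & forall y, U y ->
      quotient_factor (tchart_inv i y) = m y /\
      L2 (tchart_inv i y) = m y * L1 (tchart_inv i y).
Proof.
move=> Ez; have [L1s _ _] := PF1; have [L2s _ _] := PF2.
have Eo : open (chart_dom A i) by have [Ao _ _ _] := Ac; exact: Ao.
pose G : V * V -> R := L1 \o tchart_inv i.
pose F : V * V -> R := L2 \o tchart_inv i.
have FG y : chart_dom A i y -> G y = 0 -> F y = 0.
  by move=> /chart_domP[Ay _ _]; exact: zero12.
have [Az iz zE] := chart_domP Ez.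
have ftE L v (PF : pseudo_Finsler A L) w : A v -> dom i (tproj v) ->
    fundamental_tensor L v (tvect v) w =
    2^-1 * 'D_(0, component w i) (L \o tchart_inv i : _ -> R) (tchart i v).
  by move=> Av iv; exact: (fundamental_tensorE w Ac PF Av iv).
have [Gz|Gz] := eqVneq (G z) 0; last first.
  have : nbhs z (chart_dom A i `&` [set y | G y != 0]).
    apply: filterI; first exact: open_nbhs_nbhs.
    have cG : {for z, continuous G}.
      exact: differentiable_continuous (smooth_on_diff (L1s i) Ez).
    apply: (cG [set t | t != 0]).
    by apply: open_nbhs_nbhs; split=> //; exact: open_neq.
  rewrite nbhsE => -[U Uz UP].
  have UE : U `<=` chart_dom A i by move=> y /UP[].
  have UG y : U y -> G y != 0 by move=> /UP[].
  exists U => //; split=> //; exists (fun y => F y / G y).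
    apply/smooth_onP => k.
    have /smooth_onP/(_ k) FC := smooth_on_sub UE (L2s i).
    have /smooth_onP/(_ k) GC := smooth_on_sub UE (L1s i).
    exact: CkM Uz.1 FC (CkV Uz.1 UG GC).
  move=> y /UG Gy; split; last by rewrite divfK.
  by rewrite /quotient_factor (negbTE Gy).
have [w g10] := fundamental_tensor_neq0 Ac PF1 Az.
rewrite (ftE _ _ PF1)// zE in g10.
have Gw : 'D_(0, component w i) G z != 0.
  by apply: contra_neq g10 => ->; rewrite mulr0.
have [U Uz [UE [m ms FE]]] := local_quotient Eo (L2s i) (L1s i) FG Ez Gz Gw.
exists U => //; split => //; exists m => // y Uy; split; last exact: FE.
have Ey := UE _ Uy; have [Ay iy yE] := chart_domP Ey.
rewrite /quotient_factor; have [Gy|Gy] := eqVneq.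
  set w0 := xget _ _; move=> /=.
  have g1w0 : fundamental_tensor L1 (tchart_inv i y)
                (tvect (tchart_inv i y)) w0 != 0.
    have [w' g1w'] := fundamental_tensor_neq0 Ac PF1 Ay.
    exact: (@xgetPex _ 0 [set w | fundamental_tensor L1 (tchart_inv i y)
      (tvect (tchart_inv i y)) w != 0] (ex_intro _ w' g1w')).
  move: g1w0; rewrite (ftE _ _ PF1)// (ftE _ _ PF2)// yE => g1w0.
  rewrite (@derive_factor _ _ U _ G m _ _ (conj Uz.1 Uy) FE).
  - by rewrite /G /= Gy mul0r addr0 mulrCA mulfK.
  - exact: smooth_on_diff ms Uy.
  - exact: smooth_on_diff (L1s i) Ey.
by have := FE y Uy; rewrite /= => ->; rewrite mulfK.
Qed.

Lemma quotient_factor_smooth : tsmooth A quotient_factor.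
Proof.
move=> i; apply: smooth_on_local => z Ez.
have [U Uz [_ [m ms mE]]] := quotient_factor_local Ez.
by exists U => //; exists m => // y Uy; have [] := mE y Uy.
Qed.

Lemma quotient_factor_mul v : A v -> L2 v = quotient_factor v * L1 v.
Proof.
move=> Av; rewrite /quotient_factor; have [L10|L10] := eqVneq (L1 v) 0.
  by rewrite L10 mulr0 zero12.
by rewrite divfK.
Qed.

(** On the lightcone, D_u L2 = m D_u L1 with m the local factor, and some
    D_u L2 is nonzero because L2 is nondegenerate. *)
Lemma quotient_factor_neq0 v : A v -> (L2 v = 0 -> L1 v = 0) ->
  quotient_factor v != 0.
Proof.
move=> Av zero21; have [L10|L10] := eqVneq (L1 v) 0; last first.
  rewrite /quotient_factor (negbTE L10) mulf_neq0 ?invr_eq0//.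
  by apply: contra_neq L10.
have [i iv] := mchart_cover (tproj v).
have Ez : chart_dom A i (tchart i v) by exists v.
have [L1s _ _] := PF1.
have [U Uz [UE [m ms mE]]] := quotient_factor_local Ez.
have -> : quotient_factor v = m (tchart i v).
  by have [+ _] := mE _ Uz.2; rewrite tchartK.
have [w] := fundamental_tensor_neq0 Ac PF2 Av.
rewrite (fundamental_tensorE w Ac PF2 Av iv).
rewrite (@derive_factor _ _ U _ (L1 \o tchart_inv i : _ -> R) m _ _ Uz).
- rewrite /= tchartK// L10 mul0r addr0.
  by apply: contra_neq => ->; rewrite mul0r mulr0.
- by move=> y /mE[].
- exact: smooth_on_diff ms Uz.2.
- exact: smooth_on_diff (L1s i) Ez.
Qed.

End anisotropy.

Theorem theorem2p5 (R : realType) (n : nat) (M : manifold R n)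
    (A : set (tangent_bundle M)) (L1 L2 : tangent_bundle M -> R) :
  conic_open A -> pseudo_Finsler A L1 -> pseudo_Finsler A L2 ->
  (anisotropically_equivalent A L1 L2 <-> lightcone A L1 = lightcone A L2) /\
  (forall mu : tangent_bundle M -> R, anisotropy_factor A L1 L2 mu ->
   forall v : tangent_bundle M, A v ->
     (L1 v != 0 -> mu v = L2 v / L1 v) /\
     (forall w : tangent (tproj v),
        (L1 v = 0 \/ exists c : R, w = c *: tvect v) ->
        fundamental_tensor L1 v (tvect v) w != 0 ->
        fundamental_tensor L2 v (tvect v) w != 0 /\
        mu v = fundamental_tensor L2 v (tvect v) w /
               fundamental_tensor L1 v (tvect v) w)).
Proof.
move=> Ac PF1 PF2; split; last first.
  by move=> mu muP v; exact: anisotropy_factor_formula muP.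
split=> [[mu [mus mu0 L2E]]|coneE].
  apply/seteqP; split=> v [Av /= Lv]; split=> //=.
    by rewrite L2E// Lv mulr0.
  by move/eqP: Lv; rewrite L2E// mulf_eq0 (negbTE (mu0 v Av)) => /eqP.
have zero12 v : A v -> L1 v = 0 -> L2 v = 0.
  move=> Av Lv; have : lightcone A L1 v by [].
  by rewrite coneE => -[].
have zero21 v : A v -> L2 v = 0 -> L1 v = 0.
  move=> Av Lv; have : lightcone A L2 v by [].
  by rewrite -coneE => -[].
exists (quotient_factor L1 L2); split.
- exact: quotient_factor_smooth Ac PF1 PF2 zero12.
- move=> v Av; apply: (quotient_factor_neq0 Ac PF1 PF2 zero12 Av).
  exact: zero21.
- by move=> v; exact: quotient_factor_mul.
Qed.
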